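(* Let $n>1$ be an integer. Then $$\operatorname{per}\left[\sin\pi\frac{j+k}{n}\right]_{1\le j,k\le n-1}=\begin{cases}\dfrac{(-1)^{(n-1)/2}\,n!}{2^{n-2}(n+1)}&\text{if } 2\nmid n,\\[2mm] 0&\text{if } 2\mid n.\end{cases}$$ Also, $$\operatorname{per}\left[\cos\pi\frac{j+k}{n}\right]_{1\le j,k\le n-1}=\frac{(n-1)!}{(-2)^{n-1}}\sum_{k=0}^{n-1}\frac1{\binom{n-1}{k}}.$$
   Context: The permanent of an $N\times N$ matrix $A=[a_{j,k}]$ is $\operatorname{per}(A)=\sum_{\tau\in S_N}\prod_{j=1}^{N}a_{j,\tau(j)}$. $\sin\pi\frac{m}{n}$ means $\sin(\pi m/n)$, and similarly for $\cos$. *)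

(* Defs.v *)
From mathcomp Require Import all_boot all_order all_algebra all_fingroup.

Set Implicit Arguments.
Unset Strict Implicit.
Unset Printing Implicit Defensive.

Import GRing.Theory.

Local Open Scope ring_scope.

Definition permanent (R : comNzRingType) (N : nat) (A : 'M[R]_N) : R :=
  \sum_(t : 'S_N) \prod_(j < N) A j (t j).

(* Main.v *)
Require Import Defs.
From mathcomp Require Import all_boot all_order all_algebra all_fingroup.
From mathcomp Require Import reals trigo.
From mathcomp Require Import complex ring lra zify.

(** Put [N = n - 1], [w = exp (i pi / n)] and [z = w ^+ 2]. Euler's formulas give
    [sin (pi l / n) = (i / 2) w ^- l (1 - z ^+ l)] and
    [cos (pi l / n) = (1 / 2) w ^- l (1 + z ^+ l)]. For [l = j + k] the factor
    [w ^- l] splits into a row factor and a column factor, and over all rows and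
    columns these multiply to [w ^- (N * n) = (-1) ^+ N]. What is left in both
    cases is the permanent of a matrix [1 + x j * y k], with [y k = z ^+ k] and
    [x j = e * z ^+ j], [e] being [-1] or [1].

    Such a permanent only sees the elementary symmetric sums of [x] and [y]:
    expanding the product chosen by a permutation [t] over the set [S] of rows
    that contribute [x j * y (t j)] leaves the product of [x] over [S] times the
    product of [y] over [t @: S]; as [t] varies, [t @: S] runs over the sets of
    size [#|S|], each hit [#|S|`! * (N - #|S|)`!] times ([permanent_rank2]).

    The points [z, ..., z ^+ N] are the roots of [1 + 'X + ... + 'X^N], so their
    [m]-th elementary symmetric sum is [(-1) ^+ m] and the square of that is [1].
    Both permanents thus are [(- c) ^+ N] times the sum of
    [e ^+ m * m`! * (N - m)`!] for [m] from [0] to [N], where [c] is [i / 2] or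
    [1 / 2] ([permanent_unity_roots]). For the cosine this is the announced sum of
    inverse binomial coefficients. For the sine the sum alternates, and it
    telescopes once multiplied by [N + 2] ([sum_fact_alternating]). *)

Import Order.TTheory GRing.Theory Num.Theory.

Local Open Scope ring_scope.

(** * Permutations carrying one set to another *)

(** The permutation lists the elements of [A] first and those of its complement
    afterwards. *)
Lemma perm_initial_segment {N : nat} (A : {set 'I_N}) :
  exists s : 'S_N, s @: [set i : 'I_N | (i < #|A|)%N] = A.
Proof.
set r := enum A ++ enum (~: A).
have ur : uniq r.
  rewrite cat_uniq !enum_uniq andbT /= -all_predC; apply/allP => x.
  by rewrite /= !mem_enum inE.
have mr x : x \in r by rewrite mem_cat !mem_enum !inE orbN.
have szr : size r = N.
  by rewrite size_cat -!cardE cardsC card_ord.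
have inj_r : injective (fun i : 'I_N => nth i r i).
  move=> i j; rewrite (set_nth_default i j) ?szr // => /eqP.
  by rewrite nth_uniq ?szr // => /eqP/val_inj.
exists (perm inj_r); apply/setP => x; apply/imsetP/idP => [[k]|Ax].
  rewrite inE => kA ->; rewrite permE nth_cat -cardE kA.
  by rewrite -mem_enum mem_nth // -cardE.
have ix : (index x r < N)%N by rewrite -[X in (_ < X)%N]szr index_mem.
exists (Ordinal ix); last by rewrite permE nth_index.
by rewrite inE /= index_cat mem_enum Ax cardE index_mem mem_enum.
Qed.

Lemma perm_imset_onto {N : nat} (S T : {set 'I_N}) :
  #|S| = #|T| -> exists s : 'S_N, s @: S = T.
Proof.
move=> eST; have [s sS] := perm_initial_segment S.
have [t tT] := perm_initial_segment T.
exists (s^-1 * t)%g; rewrite -{1}sS -tT eST -imset_comp.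
by apply: eq_imset => i; rewrite /= permM permK.
Qed.

(** The sets [T] of size [#|S|] all receive the same number of permutations, since
    composing with a permutation carrying one of them to another is a bijection;
    hence each gets [N`!] divided by the number of these sets. *)
Lemma card_perm_imset {N : nat} (S T : {set 'I_N}) : #|S| = #|T| ->
  #|[set t : 'S_N | t @: S == T]| = (#|S|`! * (N - #|S|)`!)%N.
Proof.
move=> eST.
have same (U : {set 'I_N}) : #|U| == #|S| ->
    #|[set t : 'S_N | t @: S == U]| = #|[set t : 'S_N | t @: S == T]|.
  move=> /eqP eUS; have [s sU] : exists s : 'S_N, s @: U = T.
    by apply: perm_imset_onto; rewrite eUS.
  rewrite -(card_imset (mem [set t : 'S_N | t @: S == U]) (mulIg s)).
  apply: eq_card => t; rewrite inE; apply/imsetP/eqP => [[u] | tS].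
    rewrite inE => /eqP uS ->; rewrite -sU -uS -imset_comp.
    by apply: eq_imset => i; rewrite /= permM.
  exists (t * s^-1)%g; last by rewrite mulgKV.
  rewrite inE; apply/eqP.
  have -> : (t * s^-1)%g @: S = (s^-1)%g @: (t @: S).
    by rewrite -imset_comp; apply: eq_imset => i; rewrite /= permM.
  rewrite tS -sU -imset_comp -[RHS]imset_id.
  by apply: eq_imset => i; rewrite /= permK.
have leSN : (#|S| <= N)%N by rewrite -[X in (_ <= X)%N]card_ord max_card.
have Cgt0 : (0 < 'C(N, #|S|))%N by rewrite bin_gt0.
(* Count all permutations according to the image of [S]. *)
apply/eqP; rewrite -(eqn_pmul2l Cgt0) bin_fact // -card_Sn.
have -> : 'C(N, #|S|) = #|[set U : {set 'I_N} | #|U| == #|S|]|.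
  by rewrite card_draws card_ord.
rewrite -sum_nat_const; apply/eqP.
transitivity (\sum_(U : {set 'I_N} | #|U| == #|S|)
                #|[set t : 'S_N | t @: S == U]|)%N.
  by apply: eq_big => U; rewrite ?inE // => /same ->.
rewrite -[RHS]sum1_card [RHS](partition_big (fun t : 'S_N => t @: S)
  (fun U : {set 'I_N} => #|U| == #|S|)) /=; last first.
  by move=> t _; rewrite card_imset //; apply: perm_inj.
apply: eq_bigr => U _; rewrite -sum1_card; apply: eq_bigl => t.
by rewrite inE.
Qed.

(** * Permanents and elementary symmetric sums *)

Definition elem_sym {R : comNzRingType} {N : nat} (m : nat)
    (x : 'I_N -> R) : R :=
  \sum_(S : {set 'I_N} | #|S| == m) \prod_(j in S) x j.

Lemma elem_symZ {R : comNzRingType} {N : nat} (m : nat) (c : R)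
    (x : 'I_N -> R) :
  elem_sym m (fun j => c * x j) = c ^+ m * elem_sym m x.
Proof.
rewrite /elem_sym mulr_sumr; apply: eq_bigr => S /eqP <-.
by rewrite big_split prodr_const.
Qed.

(** Vieta's formulas, for a family of roots indexed by ordinals. *)
Lemma coef_prod_elem_sym {R : comNzRingType} {N : nat} (m : nat)
    (x : 'I_N -> R) :
  (m <= N)%N ->
  (\prod_(j < N) ('X - (x j)%:P))`_(N - m) = (-1) ^+ m * elem_sym m x.
Proof.
move=> leMN; rewrite -elem_symZ.
rewrite (eq_bigr (fun j => (-1 * x j)%:P + 'X)); last first.
  by move=> j _; rewrite mulN1r polyCN addrC.
rewrite bigA_distr coef_sum [RHS]big_mkcond; apply: eq_bigr => S _.
rewrite (bigID (mem S)) /=.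
rewrite (eq_bigr (fun j => (-1 * x j)%:P)) => [|j -> //].
rewrite [X in _ * X](eq_bigr (fun j => 'X)) => [|j /negbTE -> //].
rewrite -rmorph_prod /= mul_polyC coefZ.
have -> : \prod_(i | i \notin S) 'X = 'X^(N - #|S|) :> {poly R}.
  rewrite (eq_bigl (mem (~: S))) => [|i]; last by rewrite /= inE.
  by rewrite prodr_const; congr (_ ^+ _); rewrite [LHS]cardsCs setCK card_ord.
have leSN : (#|S| <= N)%N by rewrite -[X in (_ <= X)%N]card_ord max_card.
rewrite coefXn eqn_sub2lE // eq_sym.
by case: eqP; rewrite ?mulr1 ?mulr0.
Qed.

(** The factorials count the permutations that carry the set of rows contributing
    [x j * y k] to a given set of columns of the same size. *)
Lemma permanent_rank2 {R : comNzRingType} {N : nat} (x y : 'I_N -> R) :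
  permanent (\matrix_(j, k) (1 + x j * y k)) =
  \sum_(m < N.+1) (m`! * (N - m)`!)%:R * (elem_sym m x * elem_sym m y).
Proof.
have avg (S : {set 'I_N}) :
    \sum_(t : 'S_N) \prod_(j in S) y (t j) =
    (#|S|`! * (N - #|S|)`!)%:R * elem_sym #|S| y.
  rewrite (partition_big (fun t : 'S_N => t @: S)
    (fun T : {set 'I_N} => #|T| == #|S|)) /=; last first.
    by move=> t _; rewrite card_imset //; apply: perm_inj.
  rewrite mulr_sumr; apply: eq_bigr => T /eqP eTS.
  rewrite -(card_perm_imset S T) // mulr_natl -sumr_const.
  apply: eq_big => [t|t /eqP <-]; first by rewrite inE.
  by rewrite big_imset //= => i j _ _; apply: perm_inj.
transitivity (\sum_(S : {set 'I_N}) (\prod_(j in S) x j) *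
                \sum_(t : 'S_N) \prod_(j in S) y (t j)).
  under [RHS]eq_bigr do rewrite mulr_sumr.
  rewrite exchange_big; apply: eq_bigr => t _ /=.
  under eq_bigr do rewrite mxE addrC.
  rewrite bigA_distr; apply: eq_bigr => S _.
  by rewrite -big_mkcond big_split.
rewrite (partition_big (fun S : {set 'I_N} => inord #|S| : 'I_N.+1) xpredT) //=.
apply: eq_bigr => m _; rewrite [elem_sym m x]/elem_sym mulr_suml mulr_sumr.
apply: eq_big => [S|S /eqP <-]; last first.
  rewrite inordK ?avg; first by rewrite mulrCA.
  by rewrite ltnS -[X in (_ <= X)%N]card_ord max_card.
rewrite -val_eqE /= inordK //.
by rewrite ltnS -[X in (_ <= X)%N]card_ord max_card.
Qed.

Lemma permanent_scale {R : comNzRingType} {N : nat} (c : R) (a b : 'I_N -> R)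
    (A : 'M[R]_N) :
  permanent (\matrix_(j, k) (c * (a j * b k) * A j k)) =
  c ^+ N * ((\prod_j a j) * \prod_j b j) * permanent A.
Proof.
rewrite /permanent mulr_sumr; apply: eq_bigr => t _.
rewrite (eq_bigr (fun j => c * (a j * b (t j)) * A j (t j))); last first.
  by move=> j _; rewrite mxE.
rewrite !big_split /= prodr_const card_ord.
by congr (_ * (_ * _) * _); rewrite [RHS](reindex_inj (@perm_inj _ t)).
Qed.

Lemma rmorph_permanent {R S : comNzRingType} (f : {rmorphism R -> S}) {N : nat}
    (A : 'M[R]_N) : f (permanent A) = permanent (map_mx f A).
Proof.
rewrite /permanent rmorph_sum; apply: eq_bigr => t _.
by rewrite rmorph_prod; apply: eq_bigr => j _; rewrite mxE.
Qed.

(** Since [N + 2 = (N + 1 - m) + (m + 1)], multiplying [m`! * (N - m)`!] by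
    [N + 2] gives [m`! * (N + 1 - m)`! + (m + 1)`! * (N - m)`!], two consecutive
    values of [m`! * (N + 1 - m)`!]; the alternating signs cancel all but the
    extreme ones. *)
Lemma sum_fact_alternating (R : comNzRingType) (N : nat) :
  N.+2%:R * (\sum_(m < N.+1) (-1) ^+ m * (m`! * (N - m)`!)%:R) =
  (1 + (-1) ^+ N) * N.+1`!%:R :> R.
Proof.
pose f m : R := (-1) ^+ m * (m`! * (N.+1 - m)`!)%:R.
transitivity (\sum_(0 <= m < N.+1) - (f m.+1 - f m)).
  rewrite big_mkord mulr_sumr; apply: eq_bigr => m _.
  have leMN : (m <= N)%N by rewrite -ltnS.
  rewrite /f mulrCA -natrM exprS mulN1r mulNr opprB opprK -mulrDr -natrD.
  congr (_ * _%:R); rewrite subSS subSn // !factS.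
  have -> : N.+2 = ((N - m).+1 + m.+1)%N by rewrite addnS addSn subnK.
  by rewrite mulnDl mulnCA -mulnA.
rewrite sumrN telescope_sumr // opprB /f subn0 subnn muln1 fact0 mul1n exprS.
by rewrite mulN1r mulNr opprK expr0 mul1r mulrDl mul1r.
Qed.

(** * Permanents built from roots of unity *)

(** Vieta's formulas for [('X^n - 1) / ('X - 1)], all of whose coefficients are
    [1]. *)
Lemma elem_sym_unity_roots {F : fieldType} (N m : nat) (z : F) :
  N.+1.-primitive_root z -> (m <= N)%N ->
  elem_sym m (fun j : 'I_N => z ^+ j.+1) = (-1) ^+ m.
Proof.
move=> zP leMN.
have prodE : \prod_(j < N) ('X - (z ^+ j.+1)%:P) = \sum_(i < N.+1) 'X^i.
  apply: (mulfI (monic_neq0 (monicXsubC 1))).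
  rewrite -subrX1 -(factor_Xn_sub_1 zP) big_mkord big_ord_recl.
  by rewrite expr0.
have := coef_prod_elem_sym m (fun j : 'I_N => z ^+ j.+1) leMN.
rewrite prodE coef_sum.
rewrite (bigD1 (inord (N - m) : 'I_N.+1)) //= coefXn inordK ?ltnS ?leq_subr //.
rewrite eqxx big1 ?addr0 => [|i]; last first.
  rewrite -val_eqE /= inordK ?ltnS ?leq_subr // coefXn eq_sym.
  by move=> /negbTE ->.
move=> /(congr1 ( *%R ((-1) ^+ m))).
by rewrite mulr1 mulrA -expr2 sqrr_sign mul1r.
Qed.

(** The common form of the sine matrix ([c = 'i / 2], [e = -1]) and of the cosine
    matrix ([c = 1 / 2], [e = 1]). The two elementary symmetric sums contribute
    [(-1) ^+ m] each and cancel, so only the power of [e] keeps a sign. *)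
Lemma permanent_unity_roots {F : fieldType} (N : nat) (w c e : F) :
  (2 * N.+1)%N.-primitive_root w ->
  permanent (\matrix_(j < N, k < N)
    (c * (w ^- j.+1 * w ^- k.+1) * (1 + e * (w ^+ 2) ^+ (j.+1 + k.+1)))) =
  (- c) ^+ N * \sum_(m < N.+1) e ^+ m * (m`! * (N - m)`!)%:R.
Proof.
move=> wP.
have zP : N.+1.-primitive_root (w ^+ 2).
  by have := dvdn_prim_root wP (dvdn_mull 2 (dvdnn N.+1)); rewrite mulnK.
have wN : w ^+ N.+1 = -1.
  have : (w ^+ N.+1) ^+ 2 == 1 by rewrite -exprM mulnC (prim_expr_order wP).
  rewrite sqrf_eq1 => /orP[|/eqP //].
  by rewrite -(prim_order_dvd wP) => /dvdn_leq; rewrite mul2n -addnn; lia.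
pose M := \matrix_(j < N, k < N) (1 + e * (w ^+ 2) ^+ j.+1 * (w ^+ 2) ^+ k.+1).
have -> : \matrix_(j < N, k < N)
      (c * (w ^- j.+1 * w ^- k.+1) * (1 + e * (w ^+ 2) ^+ (j.+1 + k.+1))) =
    \matrix_(j, k) (c * (w ^- j.+1 * w ^- k.+1) * M j k).
  by apply/matrixP => j k; rewrite !mxE exprD mulrA.
rewrite permanent_scale permanent_rank2.
have -> : \prod_(j < N) w ^- j.+1 * \prod_(j < N) w ^- j.+1 = (-1) ^+ N.
  (* Pair the index [j + 1] with [n - (j + 1)]. *)
  rewrite {2}(reindex_inj rev_ord_inj) -big_split /=.
  rewrite (eq_bigr (fun=> -1)) ?prodr_const ?card_ord // => j _.
  by rewrite -invfM -exprD addnS subnKC // wN invrN1.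
rewrite -exprMn mulrN1; congr (_ * _); apply: eq_bigr => m _.
have leMN : (m <= N)%N by rewrite -ltnS.
rewrite elem_symZ elem_sym_unity_roots // -mulrA -expr2 sqrr_sign mulr1.
exact: mulrC.
Qed.

(** * The complex exponential on the unit circle *)

Local Open Scope complex_scope.

Definition cis {R : realType} (t : R) : R[i] := cos t +i* sin t.

Lemma cisD {R : realType} (s t : R) : cis (s + t) = cis s * cis t.
Proof.
rewrite /cis cosD sinD; apply/eqP.
by rewrite eq_complex /= [sin s * _ + _]addrC !eqxx.
Qed.

Lemma cis0 {R : realType} : cis (0 : R) = 1.
Proof. by rewrite /cis cos0 sin0. Qed.

Lemma cisN {R : realType} (t : R) : cis (- t) = (cis t)^-1.
Proof.
have tK : cis t * cis (- t) = 1 by rewrite -cisD subrr cis0.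
have t0 : cis t != 0.
  by apply: contra_eq_neq tK => ->; rewrite mul0r eq_sym oner_eq0.
by apply: (mulfI t0); rewrite tK divff.
Qed.

Lemma cisMn {R : realType} (t : R) (m : nat) : cis (t *+ m) = cis t ^+ m.
Proof. by elim: m => [|m IHm]; rewrite ?mulr0n ?cis0 // mulrS cisD IHm exprS. Qed.

(** [1 - cos t] is twice the square of [sin (t / 2)], and [t / 2] lies strictly
    between [0] and [pi]. *)
Lemma cis_neq1 {R : realType} (t : R) : 0 < t < pi *+ 2 -> cis t != 1.
Proof.
move=> /andP[t0 t2]; apply/negP => /eqP[ct st].
have : 0 < sin (t / 2).
  by apply: sin_gt0_pi; rewrite divr_gt0 //= ltr_pdivrMr // mulr_natr.
have tE : (t / 2) *+ 2 = t by rewrite -mulr_natr divfK ?pnatr_eq0.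
move: ct; rewrite -{1}tE cos_mulr2n => ct s_gt0.
have := cos2Dsin2 (t / 2); nra.
Qed.

Lemma cis_pi_div_prim (R : realType) (n : nat) : (0 < n)%N ->
  (2 * n)%N.-primitive_root (cis (pi / n%:R : R)).
Proof.
move=> n_gt0; have n0 : 0 < n%:R :> R by rewrite ltr0n.
apply/andP; split; first by rewrite muln_gt0.
apply/forallP => i; apply/eqP.
rewrite unity_rootE -cisMn; case: i => i /=.
rewrite leq_eqVlt => /orP[/eqP ->|lti]; last first.
  rewrite (negbTE (cis_neq1 _ _)) ?ltn_eqF // pmulrn_lgt0 //.
  rewrite divr_gt0 ?pi_gt0 //=.
  rewrite -[_ / _ *+ _]mulr_natr mulrAC ltr_pdivrMr //.
  rewrite -[pi *+ 2]mulr_natr -mulrA ltr_pM2l ?pi_gt0 //.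
  by rewrite -natrM ltr_nat.
rewrite eqxx; apply/eqP.
rewrite mulnC mulrnA -[_ *+ n]mulr_natr divfK ?gt_eqF //.
by rewrite /cis cos2pi sin2pi.
Qed.

(** Euler's formulas with [cis (- t)] factored out; the coefficients [-1] and [1]
    are kept visible to match [permanent_unity_roots]. *)
Lemma sin_cisE {R : realType} (t : R) :
  (sin t)%:C = 'i%C / 2 * (cis (- t) * (1 + -1 * cis (t *+ 2))).
Proof.
rewrite mulN1r mulrDr mulr1 mulrN -cisD [t *+ 2]mulr2n addKr.
have -> : cis (- t) - cis t = - (2 * 'i%C * (sin t)%:C).
  rewrite /cis cosN sinN; apply/eqP; rewrite eq_complex /=.
  by apply/andP; split; apply/eqP; ring.
rewrite mulrN !mulrA divfK ?pnatr_eq0 //.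
by rewrite -expr2 sqr_i mulN1r opprK.
Qed.

Lemma cos_cisE {R : realType} (t : R) :
  (cos t)%:C = 2^-1 * (cis (- t) * (1 + 1 * cis (t *+ 2))).
Proof.
rewrite mul1r mulrDr mulr1 -cisD [t *+ 2]mulr2n addKr.
have -> : cis (- t) + cis t = 2 * (cos t)%:C.
  rewrite /cis cosN sinN; apply/eqP; rewrite eq_complex /=.
  by apply/andP; split; apply/eqP; ring.
by rewrite mulKf ?pnatr_eq0.
Qed.
Local Close Scope complex_scope.

(** * The two permanents *)

(* Rows and columns are numbered from 0, so the ordinals j and k stand for the
   indices j.+1 and k.+1 between 1 and n - 1. *)
Theorem corollary2 (R : realType) (n : nat) (hn : (1 < n)%N) :
  permanent (\matrix_(j < n.-1, k < n.-1)
      sin (pi * (j.+1 + k.+1)%:R / n%:R : R))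
    = (if odd n then
         (-1) ^+ (n.-1)./2 * (n`!)%:R / (2 ^+ (n - 2) * (n.+1)%:R)
       else 0)
  /\
  permanent (\matrix_(j < n.-1, k < n.-1)
      cos (pi * (j.+1 + k.+1)%:R / n%:R : R))
    = (n.-1)`!%:R / (- 2) ^+ n.-1 * \sum_(0 <= k < n) ('C(n.-1, k)%:R)^-1.
Proof.
case: n hn => [|N] //= N_gt0; rewrite /= ltnS in N_gt0.
have wP := cis_pi_div_prim R N.+1 isT.
set w := cis (pi / N.+1%:R) in wP.
have angle (j k : 'I_N) : pi * (j.+1 + k.+1)%:R / N.+1%:R =
    pi / N.+1%:R *+ (j.+1 + k.+1) :> R.
  by rewrite -[RHS]mulr_natr mulrAC.
have cisNE (j k : 'I_N) : cis (- (pi / N.+1%:R *+ (j.+1 + k.+1))) =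
    w ^- j.+1 * w ^- k.+1.
  by rewrite cisN cisMn exprD invfM.
have cis2E (j k : 'I_N) : cis (pi / N.+1%:R *+ (j.+1 + k.+1) *+ 2) =
    (w ^+ 2) ^+ (j.+1 + k.+1).
  by rewrite -mulrnA mulnC mulrnA !cisMn.
split; apply: complexI; rewrite rmorph_permanent.
  rewrite [map_mx _ _](_ : _ = \matrix_(j < N, k < N)
      ('i%C / 2 * (w ^- j.+1 * w ^- k.+1) *
       (1 + -1 * (w ^+ 2) ^+ (j.+1 + k.+1)))); last first.
    apply/matrixP => j k; rewrite !mxE angle.
    rewrite [LHS]sin_cisE cisNE cis2E; ring.
  rewrite permanent_unity_roots //.
  have N2 : N.+2%:R != 0 :> R[i]%C by rewrite pnatr_eq0.
  apply: (mulfI N2); rewrite mulrCA sum_fact_alternating.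
  rewrite -signr_odd; case: (boolP (odd N)) => [oddN|evN].
    by rewrite /= expr1 subrr mul0r mulr0 rmorph0 mulr0.
  rewrite /= expr0 rmorphM fmorphV !rmorphM !rmorphXn rmorphN1 !rmorph_nat.
  have -> : (N.+1 - 2)%N = N.-1 by lia.
  have -> : (- ('i%C / 2 : R[i]%C)) ^+ N = (-1) ^+ N./2 / (2 * 2 ^+ N.-1).
    rewrite -exprS prednK // -[in LHS](even_halfK evN) -mul2n exprM.
    by rewrite sqrrN expr_div_n sqr_i expr_div_n -exprM mul2n even_halfK.
  field.
  by rewrite -natrD N2 expf_neq0 ?pnatr_eq0.
rewrite [map_mx _ _](_ : _ = \matrix_(j < N, k < N)
    (2^-1 * (w ^- j.+1 * w ^- k.+1) *
     (1 + 1 * (w ^+ 2) ^+ (j.+1 + k.+1)))); last first.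
  apply/matrixP => j k; rewrite !mxE angle.
  rewrite [LHS]cos_cisE cisNE cis2E; ring.
rewrite permanent_unity_roots //.
rewrite big_mkord !mulr_sumr rmorph_sum; apply: eq_bigr => m _ /=.
have leMN : (m <= N)%N by rewrite -ltnS.
have C0 : 'C(N, m)%:R != 0 :> R by rewrite pnatr_eq0 -lt0n bin_gt0.
have -> : N`!%:R / (- 2) ^+ N / 'C(N, m)%:R =
    (- 2^-1) ^+ N * (m`! * (N - m)`!)%:R :> R.
  by rewrite -(bin_fact leMN) natrM mulrAC mulrC [_ / 'C(N, m)%:R]mulrC mulKf //
             -exprVn invrN.
by rewrite expr1n mul1r [RHS]rmorphM rmorphXn rmorphN fmorphV !rmorph_nat.
Qed.
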